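(* Let $(\theta_n)_{n\ge1}$ be a nondecreasing sequence of positive real numbers and write $\theta=\theta_n$. In each of Case A, Case B and Case C1, as $n\to\infty$, $$\| F_{n,\theta} - \Phi \|_\infty = O\left( \frac{1}{\sqrt{\theta\{\log(1+n/\theta) - 1 + \theta/(n+\theta) \}}} \right),$$ and this bound is $$\begin{cases} O\left(1/\sqrt{\theta\log(n/\theta)}\right) & \text{in Case A},\\ O\left(1/\sqrt{\theta}\right) & \text{in Case B},\\ O\left(1/\sqrt{n^2/\theta}\right) & \text{in Case C1}.\end{cases}$$
   Context: For $\theta>0$ and a positive integer $n$, let $K=K_{n,\theta}$ be a random variable with ${\rm P}(K=x)=\bar{s}(n,x)\theta^x/(\theta)_n$ for $x=1,\ldots,n$, where $(\theta)_n=\theta(\theta+1)\cdots(\theta+n-1)$ and $\bar{s}(n,x)$ is the coefficient of $\theta^x$ in $(\theta)_n$ viewed as a polynomial in $\theta$. Let $\mu_0={\rm E}[K]=\theta\sum_{i=1}^n \frac{1}{\theta+i-1}$ and $\sigma_0^2={\rm var}(K)=\theta\sum_{i=1}^n\frac{i-1}{(\theta+i-1)^2}$. $F_{n,\theta}$ is the distribution function of $X_{n,\theta}=(K-\mu_0)/\sigma_0$, $\Phi$ is the standard normal distribution function, and $\|f\|_\infty=\sup_{x\in\mathbb{R}}|f(x)|$. The parameter $\theta=\theta_n$ may depend on $n$ and is nondecreasing in $n$ (constant $\theta$ allowed). Asymptotic regimes as $n\to\infty$: Case A: $n/\theta\to\infty$. Case B: $n/\theta\to c$ for some $0<c<\infty$.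 Case C1: $n/\theta\to0$ and $n^2/\theta\to\infty$. *)

(* Defs.v *)
From HB Require Import structures.
From mathcomp Require Import all_boot all_order all_algebra.
From mathcomp Require Import all_classical all_reals all_analysis.
From mathcomp Require Import measurable_realfun.
Set Implicit Arguments.
Unset Strict Implicit.
Unset Printing Implicit Defensive.
Import Order.TTheory GRing.Theory Num.Theory.
Import numFieldNormedType.Exports.
Local Open Scope classical_set_scope.
Local Open Scope ring_scope.

Definition pochhammer (A : pzRingType) (a : A) (n : nat) : A :=
  \prod_(i < n) (a + i%:R).

(* Coefficient of theta^x in (theta)_n, the rising factorial of 'X being
   (theta)_n viewed as a polynomial in theta. *)
Definition stirling_coef (R : realType) (n x : nat) : R :=
  (pochhammer ('X : {poly R}) n)`_x.

Definition ewens_pmf (R : realType) (n : nat) (theta : R) (x : nat) : R :=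
  stirling_coef R n x * theta ^+ x / pochhammer theta n.

(* The values 1, ..., n carry the total mass 1, so that this determines the
   distribution of K. *)
Definition has_ewens_law d (T : measurableType d) (R : realType)
    (P : probability T R) (K : {RV P >-> R}) (n : nat) (theta : R) : Prop :=
  forall x : nat, (1 <= x <= n)%N ->
    P [set w | K w = x%:R] = (ewens_pmf n theta x)%:E.

Definition standardized d (T : measurableType d) (R : realType)
    (P : probability T R) (K : {RV P >-> R}) : {RV P >-> R} :=
  (Num.sqrt (fine 'V_P[K]))^-1 \o* (K \- cst (fine 'E_P[K])).

Definition dist_fun d (T : measurableType d) (R : realType)
    (P : probability T R) (X : {RV P >-> R}) (x : R) : R :=
  fine (cdf X x).

Definition std_normal_cdf (R : realType) (x : R) : R :=
  fine (normal_prob (0 : R) 1 `]-oo, x]).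

(* The supremum in R is the genuine one only for bounded f; it is used for
   differences of two distribution functions. *)
Definition sup_norm (R : realType) (f : R -> R) : R :=
  sup [set `|f x| | x in [set: R]].

Definition caseA (R : realType) (theta : nat -> R) : Prop :=
  n%:R / theta n @[n --> \oo] --> +oo.

Definition caseB (R : realType) (theta : nat -> R) : Prop :=
  exists2 c : R, 0 < c & n%:R / theta n @[n --> \oo] --> c.

Definition caseC1 (R : realType) (theta : nat -> R) : Prop :=
  n%:R / theta n @[n --> \oo] --> (0 : R) /\
  n%:R ^+ 2 / theta n @[n --> \oo] --> +oo.

Definition be_rate (R : realType) (theta : nat -> R) (n : nat) : R :=
  let t := theta n in
  (Num.sqrt (t * (ln (1 + n%:R / t) - 1 + t / (n%:R + t))))^-1.

(* Main.v *)
Require Import Defs.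
From HB Require Import structures.
From mathcomp Require Import all_boot all_order all_algebra.
From mathcomp Require Import all_classical all_reals all_analysis.
From mathcomp Require Import measurable_realfun ring lra.
Set Implicit Arguments.
Unset Strict Implicit.
Unset Printing Implicit Defensive.
Import Order.TTheory GRing.Theory Num.Theory.
Import numFieldNormedType.Exports.
Local Open Scope classical_set_scope.
Local Open Scope ring_scope.

(** K has the law of a sum of independent Bernoulli variables with success
    probabilities p_i = theta / (theta + i), i < n.  Conditioning on the last
    summand shows by induction that E[(K - mu) f(K)] lies between var(K) times
    the mean of any lower and upper bounds, at both endpoints, of the increment
    f(x + 1) - f(x).  For f the solution of Stein's equation for the indicator
    of ]-oo, z], rescaled, such bounds come from |f| <= C, |w f(w)| <= 1 and the
    2-Lipschitz property (Mills' ratio), at the price of shifting z by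
    1 / sigma; hence the error is at most (C + 3) / sigma without any smoothing
    or concentration argument.  The quantity under the square root in the rate
    is the integral of which var(K) is a Riemann sum, and is at most
    2 var(K) + 1. *)

(** * Standard normal tails and the solution of Stein's equation *)

Section normal_cdf.
Variable R : realType.
Implicit Types x w z u v h : R.

Local Notation phi := (@normal_pdf R 0 1).
Local Notation Phi := (@std_normal_cdf R).

Lemma std_normal_pdf_gt0 x : 0 < phi x.
Proof.
by rewrite normal_pdfE ?oner_eq0// mulr_gt0 ?expR_gt0// normal_peak_gt0 ?oner_eq0.
Qed.

Lemma is_derive_std_normal_pdf x : is_derive x 1 phi (- x * phi x).
Proof.
have -> : phi = (fun y => normal_peak (1 : R) * expR (- (y ^+ 2 / 2))).
  apply/funext => y; rewrite normal_pdfE ?oner_eq0//; congr (_ * expR _).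
  by rewrite subr0 expr1n mulNr.
apply: is_derive_eq.
by rewrite /GRing.scale/=; field.
Qed.

Lemma is_derive_std_normal_cdf x : is_derive x 1 Phi (phi x).
Proof.
have x1 : x < x + 1 by rewrite ltrDl.
have itf : (@lebesgue_measure R).-integrable
    [set` Interval -oo%O (BRight (x + 1))] (EFin \o phi).
  exact: (integrableS _ _ (@subsetT _ _) (@integrable_normal_pdf R 0 1)).
have cf : {for x, continuous phi} by apply: continuous_normal_pdf; rewrite oner_eq0.
have [df f'] := continuous_FTC1 x1 itf (ltNyr _) cf.
by split; [exact: df|rewrite -derive1E].
Qed.

Lemma std_normal_cdf_ge0 x : 0 <= Phi x.
Proof. by rewrite /std_normal_cdf fine_ge0. Qed.

Lemma std_normal_cdf_le1 x : Phi x <= 1.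
Proof.
rewrite /std_normal_cdf -lee_fin fineK.
  exact: (probability_le1 (normal_prob 0 1)).
exact: (fin_num_measure (normal_prob (0 : R) 1)).
Qed.

Lemma std_normal_cdf_ndecr : {homo Phi : x y / x <= y}.
Proof.
move=> x y xy; rewrite /std_normal_cdf fine_le//.
- exact: (fin_num_measure (normal_prob (0 : R) 1)).
- exact: (fin_num_measure (normal_prob (0 : R) 1)).
apply: (le_measure (normal_prob (0 : R) 1)); rewrite ?inE//.
by move=> t /=; rewrite !in_itv/= => /le_trans; apply.
Qed.

(** The identity, as a random variable under the normal law, has distribution function [Phi]; the
    general limits of a [cdf] at both infinities then apply to [Phi]. *)
Let idTR : measurableTypeR R -> R := idfun.

#[local] HB.instance Definition _ :=
  @isMeasurableFun.Build _ _ _ _ idTR (@measurable_id _ _ setT).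

Let idRV : {RV (normal_prob (0 : R) 1) >-> R} := idTR.

Let cdf_idRV x : cdf idRV x = (Phi x)%:E.
Proof.
rewrite /std_normal_cdf fineK//.
exact: (fin_num_measure (normal_prob (0 : R) 1)).
Qed.

Lemma cvg_std_normal_cdfNy0 : Phi x @[x --> -oo] --> (0 : R).
Proof.
have := cvg_cdfNy0 idRV.
rewrite (_ : cdf idRV = EFin \o Phi); last by apply/funext => x; exact: cdf_idRV.
by move/fine_cvg.
Qed.

Lemma cvg_std_normal_cdfy1 : Phi x @[x --> +oo] --> (1 : R).
Proof.
have := cvg_cdfy1 idRV.
rewrite (_ : cdf idRV = EFin \o Phi); last by apply/funext => x; exact: cdf_idRV.
by move/fine_cvg.
Qed.

(** Mean value theorem. The bound on [df] is asked only strictly inside, so that an endpoint may sit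
    at the jump of the derivative of [stein_sol]. *)
Lemma derive_ge_incr (f df : R -> R) lo u v : u <= v ->
  (forall w, is_derive w 1 f (df w)) ->
  (forall w, u < w < v -> lo <= df w) -> lo * (v - u) <= f v - f u.
Proof.
rewrite le_eqVlt => /predU1P[<- _ _|uv fd dfb]; first by rewrite !subrr !mulr0.
have cf : {within `[u, v], continuous f}.
  by apply: derivable_within_continuous => w _; have [] := fd w.
have [c cuv ->] := MVT uv (fun w _ => fd w) cf.
by rewrite ler_pM2r ?subr_gt0//; apply: dfb; move: cuv; rewrite in_itv.
Qed.

Lemma derive_le_incr (f df : R -> R) hi u v : u <= v ->
  (forall w, is_derive w 1 f (df w)) ->
  (forall w, u < w < v -> df w <= hi) -> f v - f u <= hi * (v - u).
Proof.
move=> uv fd dfb; rewrite -lerN2 -mulNr opprB [leRHS]addrC.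
have fNd w : is_derive w 1 (fun t => - f t) (- df w).
  by have := fd w => d1; apply: is_derive_eq.
rewrite -[f u]opprK; apply: (derive_ge_incr uv fNd) => w /dfb.
by rewrite lerN2.
Qed.

(** The function [g] increases up to [w], and [g s] exceeds [w * Phi s], which vanishes as [s] goes
    to minus infinity; hence [g w] is nonnegative. *)
Lemma mills_lower_tail w : - w * Phi w <= phi w.
Proof.
pose g t := phi t + w * Phi t.
have gd (t : R) : is_derive t 1 g ((w - t) * phi t).
  have d1 := is_derive_std_normal_pdf t; have d2 := is_derive_std_normal_cdf t.
  apply: is_derive_eq; rewrite /GRing.scale/=; ring.
have key s : s <= w -> w * Phi s <= g w.
  move=> sw.
  have : 0 * (w - s) <= g w - g s.
    apply: (derive_ge_incr sw gd).
      move=> t /andP[_ tw]; rewrite mulr_ge0 ?subr_ge0 ?(ltW tw)//.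
    exact: ltW (std_normal_pdf_gt0 t).
  by have := std_normal_pdf_gt0 s; rewrite /g; lra.
have c0 : w * Phi s @[s --> -oo] --> w * 0.
  by apply: cvgMl_tmp; exact: cvg_std_normal_cdfNy0.
have : w * 0 <= g w.
  rewrite -(cvg_lim _ c0)//; apply: limr_le; first by apply/cvg_ex; exists (w * 0).
  by near=> s; apply: key; near: s; apply: nbhs_ninfty_le; exact: num_real.
by rewrite /g; lra.
Unshelve. all: by end_near. Qed.

(** Mirror argument: [g] decreases beyond [w], and its part without [phi] vanishes at plus
    infinity. *)
Lemma mills_upper_tail w : w * (1 - Phi w) <= phi w.
Proof.
pose g t := phi t - w * (1 - Phi t).
have gd (t : R) : is_derive t 1 g ((w - t) * phi t).
  have d1 := is_derive_std_normal_pdf t; have d2 := is_derive_std_normal_cdf t.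
  apply: is_derive_eq; rewrite /GRing.scale/=; ring.
have key s : w <= s -> - w * (1 - Phi s) <= g w.
  move=> ws.
  have : g s - g w <= 0 * (s - w).
    apply: (derive_le_incr ws gd) => t /andP[wt _].
    by rewrite mulr_le0_ge0 ?subr_le0 ?(ltW wt)// ltW// std_normal_pdf_gt0.
  by have := std_normal_pdf_gt0 s; rewrite /g; lra.
have c0 : - w * (1 - Phi s) @[s --> +oo] --> - w * (1 - 1).
  apply: cvgMl_tmp; apply: cvgB; first exact: cvg_cst.
  exact: cvg_std_normal_cdfy1.
have : - w * (1 - 1) <= g w.
  rewrite -(cvg_lim _ c0)//; apply: limr_le.
    by apply/cvg_ex; exists (- w * (1 - 1)).
  by near=> s; apply: key; near: s; apply: nbhs_pinfty_ge; exact: num_real.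
by rewrite /g; lra.
Unshelve. all: by end_near. Qed.

Lemma normal_peak1_le1 : normal_peak (1 : R) <= 1.
Proof.
have pi2 : 1 <= (1 : R) ^+ 2 * pi *+ 2.
  by rewrite expr1n mul1r mulr2n; have := @pi_ge2 R; lra.
rewrite invf_le1 ?sqrtr_gt0 ?(lt_le_trans _ pi2)//.
by rewrite -[leLHS]sqrtr1 ler_wsqrtr.
Qed.

Lemma std_normal_pdf_le1 x : phi x <= 1.
Proof. by rewrite (le_trans (normal_pdf_ub _ _ (oner_neq0 _)))// normal_peak1_le1. Qed.

Lemma std_normal_cdf_lip u v : u <= v -> Phi v - Phi u <= v - u.
Proof.
move=> uv; rewrite -[leRHS]mul1r; apply: (derive_le_incr uv is_derive_std_normal_cdf).
by move=> w _; exact: std_normal_pdf_le1.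
Qed.

Lemma std_normal_pdf1_le x : `|x| <= 1 -> phi 1 <= phi x.
Proof.
move=> x1; rewrite !normal_pdfE ?oner_eq0// ler_wpM2l ?normal_peak_ge0//.
rewrite ler_expR !subr0 ler_pM2r ?invr_gt0 ?expr1n ?mulrn_wgt0// lerN2.
by rewrite -(@real_normK _ x) ?num_real// expr_le1.
Qed.

(** The bounded solution of f'(w) - w f(w) = 1_{w <= z} - Phi(z); [Num.min] merges the branches
    [lower] and [upper], which meet at [z]. *)
Definition stein_sol z w : R := (phi w)^-1 * (Phi (Num.min w z) - Phi w * Phi z).

Let lower z w : R := (phi w)^-1 * (Phi w * (1 - Phi z)).
Let upper z w : R := (phi w)^-1 * (Phi z * (1 - Phi w)).

Let sol_lower z w : w <= z -> stein_sol z w = lower z w.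
Proof. by move=> wz; rewrite /stein_sol /lower min_l//; congr (_ * _); ring. Qed.

Let sol_upper z w : z <= w -> stein_sol z w = upper z w.
Proof. by move=> zw; rewrite /stein_sol /upper min_r//; congr (_ * _); ring. Qed.

Let is_derive_inv_pdf w : is_derive w 1 (fun t => (phi t)^-1) (w * (phi w)^-1).
Proof.
have pw := std_normal_pdf_gt0 w.
have d1 := is_derive_std_normal_pdf w.
have dV : is_derive w 1 (fun t => (phi t)^-1) (- (phi w) ^- 2 *: (- w * phi w)).
  by apply: is_deriveV; rewrite gt_eqF.
apply: is_derive_eq dV _; rewrite /GRing.scale/=; field.
by rewrite gt_eqF.
Qed.

Let is_derive_lower z w : is_derive w 1 (lower z) (w * lower z w + (1 - Phi z)).
Proof.
have pw := std_normal_pdf_gt0 w.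
have d1 := is_derive_inv_pdf w; have d2 := is_derive_std_normal_cdf w.
apply: is_derive_eq; rewrite /lower /GRing.scale/=; field.
by rewrite gt_eqF.
Qed.

Let is_derive_upper z w : is_derive w 1 (upper z) (w * upper z w - Phi z).
Proof.
have pw := std_normal_pdf_gt0 w.
have d1 := is_derive_inv_pdf w; have d2 := is_derive_std_normal_cdf w.
apply: is_derive_eq; rewrite /upper /GRing.scale/=; field.
by rewrite gt_eqF.
Qed.

Let sol_ge0 z w : 0 <= stein_sol z w.
Proof.
have [z0 z1] := (std_normal_cdf_ge0 z, std_normal_cdf_le1 z).
have [w0 w1] := (std_normal_cdf_ge0 w, std_normal_cdf_le1 w).
have p0 := ltW (std_normal_pdf_gt0 w).
by have [/sol_lower|/ltW /sol_upper] := lerP w z => ->;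
  rewrite !mulr_ge0 ?invr_ge0 ?subr_ge0.
Qed.

(** For fixed [w] the solution is largest at [z = w], by monotonicity of [Phi]; this makes the later
    bounds uniform in [z]. *)
Let sol_le z w : stein_sol z w <= (phi w)^-1 * (Phi w * (1 - Phi w)).
Proof.
have [z0 z1] := (std_normal_cdf_ge0 z, std_normal_cdf_le1 z).
have [w0 w1] := (std_normal_cdf_ge0 w, std_normal_cdf_le1 w).
have p0 := ltW (std_normal_pdf_gt0 w).
have [wz|/ltW zw] := lerP w z.
  rewrite sol_lower// ler_wpM2l ?invr_ge0// ler_wpM2l//.
  by have := std_normal_cdf_ndecr wz; lra.
rewrite sol_upper// ler_wpM2l ?invr_ge0// ler_wpM2r ?subr_ge0//.
exact: std_normal_cdf_ndecr.
Qed.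

(** After [sol_le], Mills' ratio controls the tail on the side given by the sign of [w]; the other
    factor is at most 1. *)
Lemma stein_sol_mul_bound z w : `|w * stein_sol z w| <= 1.
Proof.
have [w0 w1] := (std_normal_cdf_ge0 w, std_normal_cdf_le1 w).
have p0 := std_normal_pdf_gt0 w.
rewrite normrM (ger0_norm (sol_ge0 z w)).
apply: (le_trans (ler_wpM2l (normr_ge0 w) (sol_le z w))).
rewrite mulrCA mulrC ler_pdivrMr// mul1r.
have [w_ge0|w_lt0] := ger0P w.
  rewrite mulrCA (le_trans _ (mills_upper_tail w))// ler_piMl//.
  by rewrite mulr_ge0 ?subr_ge0.
rewrite mulrA (le_trans _ (mills_lower_tail w))// ler_piMr ?gerBl//.
by rewrite mulr_ge0// oppr_ge0 ltW.
Qed.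

Definition stein_const : R := (phi 1)^-1.

Lemma stein_const_ge1 : 1 <= stein_const.
Proof. by rewrite invf_ge1 ?std_normal_pdf_gt0// std_normal_pdf_le1. Qed.

(** On [-1, 1] the density is at least [phi 1]; outside, the solution is dominated by
    [w * stein_sol z w]. *)
Lemma stein_sol_bound z w : `|stein_sol z w| <= stein_const.
Proof.
have [w1|w1] := lerP `|w| 1.
  rewrite (ger0_norm (sol_ge0 z w)) (le_trans (sol_le z w))//.
  have [w0 w1'] := (std_normal_cdf_ge0 w, std_normal_cdf_le1 w).
  rewrite -[leRHS]mulr1 ler_pM ?invr_ge0 ?mulr_ge0 ?subr_ge0//.
  - exact: ltW (std_normal_pdf_gt0 w).
  - by rewrite lef_pV2 ?posrE ?std_normal_pdf_gt0// std_normal_pdf1_le.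
  - by rewrite mulr_ile1 ?subr_ge0// gerBl.
apply: le_trans stein_const_ge1.
have := stein_sol_mul_bound z w; rewrite normrM; apply: le_trans.
by rewrite ler_peMl// ltW.
Qed.

(* Away from [z] this is the derivative of [stein_sol z], by Stein's equation. *)
Let dsol z w : R := w * stein_sol z w + (w <= z)%R%:R - Phi z.

Let sol_ge_incr z lo u v : u <= v ->
  (forall w, u < w < v -> lo <= dsol z w) ->
  lo * (v - u) <= stein_sol z v - stein_sol z u.
Proof.
move=> uv dlo.
have low a b : u <= a -> a <= b -> b <= v -> b <= z ->
    lo * (b - a) <= stein_sol z b - stein_sol z a.
  move=> ua ab bv bz; rewrite !sol_lower ?(le_trans ab)//.
  apply: (derive_ge_incr ab (is_derive_lower z)) => w /andP[aw wb].
  have wz : w <= z by rewrite ltW// (lt_le_trans wb).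
  have := dlo w; rewrite /dsol (le_lt_trans ua aw) (lt_le_trans wb bv) wz sol_lower//.
  by move=> /(_ erefl) /=; lra.
have upp a b : u <= a -> a <= b -> b <= v -> z <= a ->
    lo * (b - a) <= stein_sol z b - stein_sol z a.
  move=> ua ab bv za; rewrite !sol_upper ?(le_trans za)//.
  apply: (derive_ge_incr ab (is_derive_upper z)) => w /andP[aw wb].
  have zw : z < w by rewrite (le_lt_trans za).
  have := dlo w; rewrite /dsol (le_lt_trans ua aw) (lt_le_trans wb bv) [w <= z]leNgt zw.
  by rewrite (sol_upper (ltW zw)) => /(_ erefl) /=; lra.
(* An interval containing [z] inside is cut there, and the increments of the two smooth branches add
   up. *)
have [vz|zv] := lerP v z; first exact: low.
have [zu|uz] := lerP z u; first exact: upp.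
have := low u z (lexx _) (ltW uz) (ltW zv) (lexx _).
have := upp z v (ltW uz) (ltW zv) (lexx _) (lexx _).
lra.
Qed.

Let sol_le_incr z hi u v : u <= v ->
  (forall w, u < w < v -> dsol z w <= hi) ->
  stein_sol z v - stein_sol z u <= hi * (v - u).
Proof.
move=> uv dhi.
have low a b : u <= a -> a <= b -> b <= v -> b <= z ->
    stein_sol z b - stein_sol z a <= hi * (b - a).
  move=> ua ab bv bz; rewrite !sol_lower ?(le_trans ab)//.
  apply: (derive_le_incr ab (is_derive_lower z)) => w /andP[aw wb].
  have wz : w <= z by rewrite ltW// (lt_le_trans wb).
  have := dhi w; rewrite /dsol (le_lt_trans ua aw) (lt_le_trans wb bv) wz sol_lower//.
  by move=> /(_ erefl) /=; lra.
have upp a b : u <= a -> a <= b -> b <= v -> z <= a ->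
    stein_sol z b - stein_sol z a <= hi * (b - a).
  move=> ua ab bv za; rewrite !sol_upper ?(le_trans za)//.
  apply: (derive_le_incr ab (is_derive_upper z)) => w /andP[aw wb].
  have zw : z < w by rewrite (le_lt_trans za).
  have := dhi w; rewrite /dsol (le_lt_trans ua aw) (lt_le_trans wb bv) [w <= z]leNgt zw.
  by rewrite (sol_upper (ltW zw)) => /(_ erefl) /=; lra.
have [vz|zv] := lerP v z; first exact: low.
have [zu|uz] := lerP z u; first exact: upp.
have := low u z (lexx _) (ltW uz) (ltW zv) (lexx _).
have := upp z v (ltW uz) (ltW zv) (lexx _) (lexx _).
lra.
Qed.

Let dsol_bound z w : - 2 <= dsol z w <= 2.
Proof.
have := stein_sol_mul_bound z w; rewrite ler_norml => /andP[].
have [z0 z1] := (std_normal_cdf_ge0 z, std_normal_cdf_le1 z).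
by rewrite /dsol; case: (w <= z) => /= *; lra.
Qed.

Lemma stein_sol_lip z u v : `|stein_sol z v - stein_sol z u| <= 2 * `|v - u|.
Proof.
wlog uv : u v / u <= v => [hw|].
  case/orP: (le_total u v) => [/hw//|vu].
  by rewrite distrC [`|v - u|]distrC; exact: hw.
rewrite ler_norml -mulNr (ger0_norm (_ : 0 <= v - u)) ?subr_ge0//.
by rewrite sol_ge_incr ?sol_le_incr// => w _; have /andP[] := dsol_bound z w.
Qed.

Let mul_sol_lip z h w b : `|w - b| <= h ->
  `|w * stein_sol z w - b * stein_sol z b| <= (stein_const + 2 * `|b|) * h.
Proof.
move=> wbh.
have -> : w * stein_sol z w - b * stein_sol z b =
  (w - b) * stein_sol z w + b * (stein_sol z w - stein_sol z b) by ring.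
rewrite (le_trans (ler_normD _ _))// (normrM (w - b)) (normrM b) mulrDl lerD//.
  by rewrite [leRHS]mulrC; apply: ler_pM => //; exact: stein_sol_bound.
rewrite [2 * _]mulrC -mulrA ler_wpM2l// (le_trans (stein_sol_lip z b w))//.
by rewrite ler_wpM2l.
Qed.

(** Each [w] between [u] and [u + h] is within [h] of [b], so [b <= z - h] forces [w <= z]: shifting
    the threshold replaces the indicator at [w] by one at [b]. A free [b] covers both endpoints, as
    [ewens_stein_ge] demands. *)
Lemma stein_sol_incr_ge z u b h : 0 <= h -> u <= b <= u + h ->
  h * (b * stein_sol z b + (b <= z - h)%R%:R - Phi z
       - (stein_const + 2 * `|b|) * h)
  <= stein_sol z (u + h) - stein_sol z u.
Proof.
move=> h0 /andP[ub bh]; rewrite mulrC -[X in _ * X](addKr u h) [- u + _]addrC.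
apply: sol_ge_incr => [|w /andP[uw wh]]; first by rewrite lerDl.
have wb : `|w - b| <= h by rewrite ler_norml; apply/andP; split; lra.
have := mul_sol_lip z wb; rewrite ler_norml => /andP[+ _].
rewrite /dsol; have : ((b <= z - h)%R%:R : R) <= (w <= z)%R%:R.
  rewrite ler_nat; have [bz|//] := boolP (b <= z - h).
  by rewrite (_ : w <= z)//; lra.
lra.
Qed.

Lemma stein_sol_incr_le z u b h : 0 <= h -> u <= b <= u + h ->
  stein_sol z (u + h) - stein_sol z u <=
  h * (b * stein_sol z b + (b <= z + h)%R%:R - Phi z
       + (stein_const + 2 * `|b|) * h).
Proof.
move=> h0 /andP[ub bh]; rewrite mulrC -[X in _ * X](addKr u h) [- u + _]addrC.
apply: sol_le_incr => [|w /andP[uw wh]]; first by rewrite lerDl.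
have wb : `|w - b| <= h by rewrite ler_norml; apply/andP; split; lra.
have := mul_sol_lip z wb; rewrite ler_norml => /andP[_].
rewrite /dsol; have : ((w <= z)%R%:R : R) <= (b <= z + h)%R%:R.
  rewrite ler_nat; have [wz|//] := boolP (w <= z).
  by rewrite (_ : b <= z + h)//; lra.
lra.
Qed.

End normal_cdf.

(** * The Ewens law as a Bernoulli sum, and its Stein inequalities *)

Section ewens.
Variable R : realType.
Implicit Types (n : nat) (t : R) (f g m : R -> R).

Lemma pochhammerS (A : pzRingType) (a : A) n :
  pochhammer a n.+1 = pochhammer a n * (a + n%:R).
Proof. by rewrite /pochhammer big_ord_recr. Qed.

Lemma pochhammer_gt0 t n : 0 < t -> 0 < pochhammer t n.
Proof. by move=> t0; apply: prodr_gt0 => i _; rewrite ltr_pwDl. Qed.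

Lemma stirling_coefS0 n : stirling_coef R n.+1 0 = n%:R * stirling_coef R n 0.
Proof.
by rewrite /stirling_coef pochhammerS mulrDr coefD coefMX add0r -polyC_natr coefMC mulrC.
Qed.

Lemma stirling_coefSS n (x : nat) : stirling_coef R n.+1 x.+1 =
  stirling_coef R n x + n%:R * stirling_coef R n x.+1.
Proof.
by rewrite /stirling_coef pochhammerS mulrDr coefD coefMX -polyC_natr coefMC [_ * n%:R]mulrC.
Qed.

Lemma stirling_coef_ge0 n (x : nat) : 0 <= stirling_coef R n x.
Proof.
elim: n x => [|n IHn] [|x].
- by rewrite /stirling_coef /pochhammer big_ord0 coef1.
- by rewrite /stirling_coef /pochhammer big_ord0 coef1.
- by rewrite stirling_coefS0 mulr_ge0.
- by rewrite stirling_coefSS addr_ge0// mulr_ge0.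
Qed.

Lemma stirling_coef_gt n (x : nat) : (n < x)%N -> stirling_coef R n x = 0.
Proof.
elim: n x => [|n IHn] [|x]// nx.
  by rewrite /stirling_coef /pochhammer big_ord0 coef1.
by rewrite stirling_coefSS !IHn// ?mulr0 ?addr0// ltnW.
Qed.

Lemma stirling_coef_n0 n : (0 < n)%N -> stirling_coef R n 0 = 0.
Proof.
case: n => // n _; elim: n => [|n IHn]; first by rewrite stirling_coefS0 mul0r.
by rewrite stirling_coefS0 IHn mulr0.
Qed.

Lemma ewens_pmf_ge0 n t (x : nat) : 0 < t -> 0 <= ewens_pmf n t x.
Proof.
move=> t0; rewrite /ewens_pmf divr_ge0 ?(ltW (pochhammer_gt0 _ _))//.
by rewrite mulr_ge0 ?stirling_coef_ge0// exprn_ge0 ?ltW.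
Qed.

(* The success probability of the i-th of the independent Bernoulli variables
   whose sum has the Ewens law. *)
Definition new_prob t (i : nat) : R := t / (t + i%:R).

Lemma ewens_pmfS0 n t : 0 < t ->
  ewens_pmf n.+1 t 0 = (1 - new_prob t n) * ewens_pmf n t 0.
Proof.
move=> t0; have /gt_eqF pn0 := pochhammer_gt0 n t0.
have tn0 : t + n%:R != 0 by rewrite gt_eqF// ltr_pwDl.
rewrite /ewens_pmf /new_prob stirling_coefS0 pochhammerS; field.
by rewrite pn0 tn0.
Qed.

Lemma ewens_pmfSS n t (x : nat) : 0 < t -> ewens_pmf n.+1 t x.+1 =
  (1 - new_prob t n) * ewens_pmf n t x.+1 + new_prob t n * ewens_pmf n t x.
Proof.
move=> t0; have /gt_eqF pn0 := pochhammer_gt0 n t0.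
have tn0 : t + n%:R != 0 by rewrite gt_eqF// ltr_pwDl.
rewrite /ewens_pmf /new_prob stirling_coefSS pochhammerS exprS; field.
by rewrite pn0 tn0.
Qed.

(** The value 0 is included: it carries all the mass for [n = 0], the start of the inductions, and
    none for positive [n]. *)
Definition ewens_mean n t f : R := \sum_(x < n.+1) ewens_pmf n t x * f x%:R.

Lemma eq_ewens_mean n t f g : f =1 g -> ewens_mean n t f = ewens_mean n t g.
Proof. by move=> fg; apply: eq_bigr => i _; rewrite fg. Qed.

Lemma ewens_meanD n t f g :
  ewens_mean n t (fun x => f x + g x) = ewens_mean n t f + ewens_mean n t g.
Proof. by rewrite /ewens_mean -big_split/=; apply: eq_bigr => i _; rewrite mulrDr. Qed.

Lemma ewens_meanZ n t (k : R) f :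
  ewens_mean n t (fun x => k * f x) = k * ewens_mean n t f.
Proof. by rewrite /ewens_mean mulr_sumr; apply: eq_bigr => i _; rewrite mulrCA. Qed.

Lemma ewens_meanS n t f : 0 < t -> ewens_mean n.+1 t f =
  (1 - new_prob t n) * ewens_mean n t f
  + new_prob t n * ewens_mean n t (fun x => f (x + 1)).
Proof.
move=> t0; rewrite /ewens_mean big_ord_recl/= ewens_pmfS0//.
under eq_bigr do rewrite /bump/= add1n ewens_pmfSS// mulrDl
  -(mulrA (1 - _)) -(mulrA (new_prob _ _)).
rewrite big_split/= -!mulr_sumr addrA; congr (_ + _ * _).
  rewrite -mulrA -mulrDr; congr (_ * _).
  (* This sum reaches one value too far, [n.+1], where the mass is zero. *)
  rewrite big_ord_recr/= [ewens_pmf n t n.+1]/ewens_pmf stirling_coef_gt// !mul0r addr0.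
  by rewrite [RHS]big_ord_recl.
by apply: eq_bigr => i _; rewrite natr1.
Qed.

Lemma ewens_mean_cst n t (c : R) : 0 < t -> ewens_mean n t (fun=> c) = c.
Proof.
move=> t0; elim: n => [|n IHn]; last by rewrite ewens_meanS// IHn; ring.
rewrite /ewens_mean big_ord1 /ewens_pmf /stirling_coef /pochhammer !big_ord0.
by rewrite coef1 expr0 mulr1 divr1 mul1r.
Qed.

Lemma ewens_mean_le n t f g : 0 < t -> (forall x, f x <= g x) ->
  ewens_mean n t f <= ewens_mean n t g.
Proof. by move=> t0 fg; apply: ler_sum => i _; rewrite ler_wpM2l// ewens_pmf_ge0. Qed.

Definition ewens_mu n t : R := \sum_(i < n) new_prob t i.
Definition ewens_var n t : R := \sum_(i < n) new_prob t i * (1 - new_prob t i).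

Lemma new_prob_itv t i : 0 < t -> 0 <= new_prob t i <= 1.
Proof.
move=> t0; have ti : 0 < t + i%:R by rewrite ltr_pwDl.
by rewrite divr_ge0 ?(ltW ti) ?(ltW t0)//= ler_pdivrMr// mul1r lerDl.
Qed.

(** Conditioning on the last summand, with success probability [p], gives the induction hypothesis
    for [f] and for its shift, plus [p * (1 - p)] times the mean increment of [f]. Weighting the two
    bounds on that increment by [1 - p] and [p] rebuilds the mean of [m] under the law for
    [n.+1]. *)
Lemma ewens_stein_ge n t f m : 0 < t ->
  (forall x, m x <= f (x + 1) - f x) ->
  (forall x, m (x + 1) <= f (x + 1) - f x) ->
  ewens_var n t * ewens_mean n t m <=
  ewens_mean n t (fun x => (x - ewens_mu n t) * f x).
Proof.
move=> t0; elim: n f m => [|n IHn] f m m0 m1.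
  rewrite /ewens_var /ewens_mu !big_ord0 mul0r /ewens_mean big_ord1.
  by rewrite subr0 mul0r mulr0 lexx.
have /andP[p0 p1] := new_prob_itv n t0.
have IH0 := IHn f m m0 m1.
have IH1 := IHn (fun x => f (x + 1)) (fun x => m (x + 1)) (fun x => m0 _) (fun x => m1 _).
rewrite /ewens_var /ewens_mu !big_ord_recr/= -/(ewens_var n t) -/(ewens_mu n t).
rewrite !ewens_meanS//; set p := new_prob t n in p0 p1 *.
set v := ewens_var n t in IH0 IH1 *; set mu := ewens_mu n t in IH0 IH1 *.
set E := ewens_mean n t in IH0 IH1 *.
have -> : E (fun x => (x - (mu + p)) * f x) =
    E (fun x => (x - mu) * f x) + - p * E f.
  by rewrite -ewens_meanZ -ewens_meanD; apply: eq_ewens_mean => x; ring.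
have -> : E (fun x => (x + 1 - (mu + p)) * f (x + 1)) =
    E (fun x => (x - mu) * f (x + 1)) + (1 - p) * E (fun x => f (x + 1)).
  by rewrite -ewens_meanZ -ewens_meanD; apply: eq_ewens_mean => x; ring.
have Em0 : E m <= E (fun x => f (x + 1)) - E f.
  rewrite -mulN1r -ewens_meanZ -ewens_meanD; apply: ewens_mean_le => // x.
  by rewrite mulN1r.
have Em1 : E (fun x => m (x + 1)) <= E (fun x => f (x + 1)) - E f.
  rewrite -mulN1r -ewens_meanZ -ewens_meanD; apply: ewens_mean_le => // x.
  by rewrite mulN1r.
have q0 : 0 <= 1 - p by rewrite subr_ge0.
have a0 := ler_wpM2l q0 IH0; have a1 := ler_wpM2l p0 IH1.
have pq0 : 0 <= p * (1 - p) by rewrite mulr_ge0.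
have b0 := ler_wpM2l pq0 (ler_wpM2l q0 Em0).
have b1 := ler_wpM2l pq0 (ler_wpM2l p0 Em1).
lra.
Qed.

Lemma ewens_stein_le n t f m : 0 < t ->
  (forall x, f (x + 1) - f x <= m x) ->
  (forall x, f (x + 1) - f x <= m (x + 1)) ->
  ewens_mean n t (fun x => (x - ewens_mu n t) * f x) <=
  ewens_var n t * ewens_mean n t m.
Proof.
move=> t0 m0 m1.
have m0' x : -1 * m x <= -1 * f (x + 1) - -1 * f x by have := m0 x; lra.
have m1' x : -1 * m (x + 1) <= -1 * f (x + 1) - -1 * f x by have := m1 x; lra.
have -> : ewens_mean n t (fun x => (x - ewens_mu n t) * f x) =
    -1 * ewens_mean n t (fun x => (x - ewens_mu n t) * (-1 * f x)).
  by rewrite -ewens_meanZ; apply: eq_ewens_mean => x; ring.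
by have := ewens_stein_ge n t0 m0' m1'; rewrite ewens_meanZ; lra.
Qed.

(** Both Stein inequalities at the constant function 1, whose increments are 0. *)
Lemma ewens_mean_centered n t : 0 < t ->
  ewens_mean n t (fun x => x - ewens_mu n t) = 0.
Proof.
move=> t0; rewrite -(@eq_ewens_mean _ _ (fun x => (x - ewens_mu n t) * 1)); last first.
  by move=> x; rewrite mulr1.
have := @ewens_stein_ge n t (fun=> 1) (fun=> 0) t0.
have := @ewens_stein_le n t (fun=> 1) (fun=> 0) t0.
rewrite ewens_mean_cst// mulr0 subrr => le0 ge0.
by apply/eqP; rewrite eq_le le0// ge0.
Qed.

(** Both Stein inequalities at the centred identity, whose increments are 1. *)
Lemma ewens_mean_sqr n t : 0 < t ->
  ewens_mean n t (fun x => (x - ewens_mu n t) ^+ 2) = ewens_var n t.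
Proof.
move=> t0; apply/eqP; rewrite eq_le.
pose f x := x - ewens_mu n t.
have fS (x : R) : f (x + 1) - f x = 1 by rewrite /f; ring.
have := @ewens_stein_ge n t f (fun=> 1) t0.
have := @ewens_stein_le n t f (fun=> 1) t0.
rewrite ewens_mean_cst// mulr1 => -> //; do ?by move=> ?; rewrite fS.
by move=> -> // ?; rewrite fS.
Qed.

End ewens.

(** * Berry-Esseen bounds for the Ewens masses *)

Section berry_esseen.
Variables (R : realType) (n : nat) (t : R).
Hypotheses (t0 : 0 < t) (v0 : 0 < ewens_var n t).
Implicit Types x z : R.

Local Notation E := (ewens_mean n t).
Local Notation mu := (ewens_mu n t).
Local Notation Phi := (@std_normal_cdf R).
Local Notation C0 := (@stein_const R).

Let h := (Num.sqrt (ewens_var n t))^-1.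
Let w x := h * (x - mu).

Let h_gt0 : 0 < h. Proof. by rewrite invr_gt0 sqrtr_gt0. Qed.

Let varE : ewens_var n t * h * h = 1.
Proof.
rewrite -mulrA -invfM -expr2 sqr_sqrtr ?(ltW v0)// divff// gt_eqF//.
Qed.

Let w_shift x : w (x + 1) = w x + h.
Proof. by rewrite /w; ring. Qed.

Let mean_norm_w : E (fun x => 2 * `|w x|) <= 2.
Proof.
(* The standardized variable has second moment 1, so 2|w| <= 1 + w^2 suffices. *)
have le2 x : 2 * `|w x| <= 1 + h * h * (x - mu) ^+ 2.
  have -> : h * h * (x - mu) ^+ 2 = `|w x| ^+ 2.
    by rewrite real_normK ?num_real// /w; ring.
  by have := sqr_ge0 (1 - `|w x|); lra.
apply: (le_trans (ewens_mean_le _ t0 le2)).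
rewrite ewens_meanD ewens_meanZ ewens_mean_cst// ewens_mean_sqr//.
by rewrite mulrC mulrA varE; lra.
Qed.


(** Since variance times [h * h] is 1, the [w * stein_sol] term is exactly the left side of the
    Stein inequalities and cancels there, leaving a bare distribution function. The sign [c] is -1
    for the upper and 1 for the lower bound. *)
Let mean_stein z s (c : R) :
  ewens_var n t * E (fun x => h * (w x * stein_sol z (w x) + (w x <= s)%R%:R
    - Phi z + c * (C0 + 2 * `|w x|) * h)) =
  E (fun x => (x - mu) * stein_sol z (w x)) +
  ewens_var n t * h * (E (fun x => (w x <= s)%R%:R) - Phi z
    + c * h * C0 + c * h * E (fun x => 2 * `|w x|)).
Proof.
have -> : E (fun x => (x - mu) * stein_sol z (w x)) =
    ewens_var n t * h * E (fun x => w x * stein_sol z (w x)).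
  rewrite -ewens_meanZ; apply: eq_ewens_mean => x.
  have -> : ewens_var n t * h * (w x * stein_sol z (w x)) =
    ewens_var n t * h * h * ((x - mu) * stein_sol z (w x)) by rewrite /w; ring.
  by rewrite varE mul1r.
rewrite -mulrDr -mulrA; congr (_ * _); rewrite ewens_meanZ; congr (_ * _).
rewrite -(ewens_meanZ _ _ (c * h)) addrA -[_ - Phi z + c * h * C0]addrA.
rewrite -(ewens_mean_cst n (- Phi z + c * h * C0) t0) !addrA -!ewens_meanD.
by apply: eq_ewens_mean => x; ring.
Qed.

Lemma ewens_cdf_le z : E (fun x => (w x <= z)%R%:R) <= Phi z + (C0 + 3) * h.
Proof.
(* Solving at [z + h] puts the shifted indicator at [z]. In [C0 + 3], the 3 is 1 for moving [Phi]
   back by [h] plus 2 from [mean_norm_w]. *)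
pose y := z + h.
have zy : z = y - h by rewrite /y; ring.
have incr x b : (b = w x) \/ (b = w (x + 1)) ->
    h * (b * stein_sol y b + (b <= z)%R%:R - Phi y + -1 * (C0 + 2 * `|b|) * h)
    <= stein_sol y (w (x + 1)) - stein_sol y (w x).
  move=> bE; rewrite w_shift zy mulN1r mulNr; apply: stein_sol_incr_ge; first exact: ltW.
  have := h_gt0; case: bE => ->; rewrite ?w_shift => h0; apply/andP; split; lra.
have := ewens_stein_ge n t0 (fun x => incr x (w x) (or_introl erefl))
  (fun x => incr x (w (x + 1)) (or_intror erefl)).
rewrite mean_stein gerDl pmulr_rle0 ?mulr_gt0//.
have zyh : z <= y by rewrite /y lerDl ltW.
have := std_normal_cdf_lip zyh; have := mean_norm_w; have := h_gt0.
rewrite {2}/y; nra.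
Qed.

Lemma ewens_cdf_ge z : Phi z - (C0 + 3) * h <= E (fun x => (w x <= z)%R%:R).
Proof.
pose y := z - h.
have zy : z = y + h by rewrite /y; ring.
have incr x b : (b = w x) \/ (b = w (x + 1)) ->
    stein_sol y (w (x + 1)) - stein_sol y (w x) <=
    h * (b * stein_sol y b + (b <= z)%R%:R - Phi y + 1 * (C0 + 2 * `|b|) * h).
  move=> bE; rewrite w_shift zy mul1r; apply: stein_sol_incr_le; first exact: ltW.
  have := h_gt0; case: bE => ->; rewrite ?w_shift => h0; apply/andP; split; lra.
have := ewens_stein_le n t0 (fun x => incr x (w x) (or_introl erefl))
  (fun x => incr x (w (x + 1)) (or_intror erefl)).
rewrite mean_stein lerDl pmulr_rge0 ?mulr_gt0//.
have yzh : y <= z by rewrite /y gerBl ltW.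
have := std_normal_cdf_lip yzh; have := mean_norm_w; have := h_gt0.
rewrite {2}/y; nra.
Qed.

End berry_esseen.

(** * Transfer to a random variable with the Ewens law *)

Section ewens_law.
Variables (d : measure_display) (T : measurableType d) (R : realType).
Variables (P : probability T R) (K : {RV P >-> R}) (n : nat) (t : R).
Hypotheses (n0 : (0 < n)%N) (t0 : 0 < t) (K_law : has_ewens_law K n t).

Let A (i : nat) : set T := K @^-1` [set i.+1%:R].

Let mA i : measurable (A i).
Proof.
by rewrite -[A i]setTI; apply: measurable_funP => //; exact: measurable_set1.
Qed.

Let PA (i : 'I_n) : P (A i) = (ewens_pmf n t i.+1)%:E.
Proof. by apply: K_law; rewrite /= ltn_ord. Qed.

Let indicA (i j : nat) w : A i w -> \1_(A j) w = (i == j)%:R :> R.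
Proof.
rewrite /A /= indicE => Kw; congr (_%:R); congr nat_of_bool.
apply/idP/eqP => [|<-]; last by rewrite inE.
by rewrite inE /= Kw => /eqP; rewrite eqr_nat => /eqP[].
Qed.

Let ewens_mean_pos (g : R -> R) :
  ewens_mean n t g = \sum_(i < n) ewens_pmf n t i.+1 * g i.+1%:R.
Proof.
rewrite /ewens_mean big_ord_recl {1}/ewens_pmf/= stirling_coef_n0// !mul0r add0r.
exact: eq_bigr.
Qed.

Let D := \big[setU/set0]_(i < n) A i.

Let mD : measurable D.
Proof. exact: bigsetU_measurable. Qed.

Let PD : P D = 1%E.
Proof.
rewrite measure_bigsetU//; last first.
  apply/trivIsetP => i j _ _ ij; apply/seteqP; split => // w [Ai Aj].
  have := indicA j Ai; rewrite (negbTE ij) indicE mem_set// => /eqP.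
  by rewrite oner_eq0.
rewrite (eq_bigr _ (fun i _ => PA i)) sumEFin; congr EFin.
rewrite -[RHS](ewens_mean_cst n 1 t0) ewens_mean_pos.
by apply: eq_bigr => i _; rewrite mulr1.
Qed.

(** The atoms [A i] fill the set [D] of probability 1, so [g (K w)] agrees almost everywhere with a
    finite combination of their indicators. *)
Lemma ewens_integral (g : R -> R) : measurable_fun setT g ->
  (\int[P]_w (g (K w))%:E = (ewens_mean n t g)%:E)%E.
Proof.
move=> mg.
pose S (i : nat) w : \bar R := ((g i.+1%:R)%:E * (\1_(A i) w)%:E)%E.
have iS i : P.-integrable setT (S i).
  by apply: integrableZl => //; exact: integrable_indic.
rewrite (ae_eq_integral (fun w => \sum_(i < n) S i w)%E) => //.
- rewrite integral_sum// ewens_mean_pos -sumEFin; apply: eq_bigr => i _.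
  rewrite integralZl//; last exact: integrable_indic.
  rewrite integral_indic// setIT mulrC EFinM.
  by congr (_ * _)%E; exact: PA.
- by apply/measurable_EFinP; exact: measurableT_comp.
- by apply: (measurable_int P); apply: integrable_sum.
exists (~` D); split; first exact: measurableC.
  by apply: (etrans (probability_setC P mD)); rewrite PD subee.
move=> w /= NE Dw; apply: NE => _.
move: Dw; rewrite /D -bigcup_mkord => -[i /= iltn Ai].
rewrite (bigD1 (Ordinal iltn))//= big1 => [|j]; last first.
  rewrite -val_eqE/= /S (indicA j Ai) eq_sym => /negbTE ->.
  by rewrite mule0.
by rewrite adde0 /S (indicA i Ai) eqxx mule1 -Ai.
Qed.

Lemma ewens_expectation : ('E_P[K] = (ewens_mu n t)%:E)%E.
Proof.
transitivity ((ewens_mean n t idfun)%:E)%E.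
  by rewrite expectation.unlock; exact: (ewens_integral (@measurable_id _ _ setT)).
congr EFin.
have := ewens_mean_centered n t0; rewrite ewens_meanD ewens_mean_cst//.
by move/eqP; rewrite subr_eq0 => /eqP.
Qed.

Lemma ewens_variance : ('V_P[K] = (ewens_var n t)%:E)%E.
Proof.
rewrite /variance covariance.unlock ewens_expectation/= expectation.unlock.
rewrite -ewens_mean_sqr//.
rewrite -(@ewens_integral (fun x => (x - ewens_mu n t) ^+ 2)).
  by apply: eq_integral => w _; rewrite expr2.
by apply: measurable_funX; exact: measurable_funB.
Qed.

Lemma ewens_standardized_cdf (z : R) : dist_fun (standardized K) z =
  ewens_mean n t (fun x =>
    ((Num.sqrt (ewens_var n t))^-1 * (x - ewens_mu n t) <= z)%R%:R).
Proof.
set s := Num.sqrt _.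
pose B : set R := [set x | s^-1 * (x - ewens_mu n t) <= z].
have mB : measurable B.
  have mf : measurable_fun setT (fun x : R => s^-1 * (x - ewens_mu n t)).
    by apply: measurable_funM => //; exact: measurable_funB.
  by have := mf measurableT _ (measurable_itv `]-oo, z]); rewrite setTI.
have mKB : measurable (K @^-1` B).
  by rewrite -[_ @^-1` _]setTI; exact: measurable_funP.
transitivity (ewens_mean n t \1_B); last first.
  apply: eq_ewens_mean => x; rewrite indicE; congr (_%:R); congr nat_of_bool.
  by apply/idP/idP; rewrite inE.
rewrite /dist_fun -[RHS]/(fine (ewens_mean n t \1_B)%:E) -ewens_integral//.
have -> : (\int[P]_w (\1_B (K w))%:E)%E = P (K @^-1` B).
  transitivity (\int[P]_w (\1_(K @^-1` B) w)%:E)%E; last by rewrite integral_indic// setIT.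
  by apply: eq_integral => w _; rewrite !indicE.
congr fine; rewrite /cdf /distribution /pushforward; congr (P _).
apply/seteqP; split => w; rewrite /B /standardized /= in_itv/=;
  by rewrite ewens_expectation ewens_variance/= mulrC.
Qed.

Lemma ewens_berry_esseen : 0 < ewens_var n t ->
  0 <= sup_norm (fun x => dist_fun (standardized K) x - std_normal_cdf x) <=
  (stein_const R + 3) / Num.sqrt (ewens_var n t).
Proof.
move=> v0; rewrite /sup_norm; set S := (X in sup X).
have S0 : S `|dist_fun (standardized K) 0 - std_normal_cdf 0| by exists 0.
have Sub : ubound S ((stein_const R + 3) / Num.sqrt (ewens_var n t)).
  move=> _ [z _ <-]; rewrite ewens_standardized_cdf ler_distl.
  by rewrite ewens_cdf_le ?ewens_cdf_ge.
rewrite ge_sup ?andbT//; last by exists `|dist_fun (standardized K) 0 - std_normal_cdf 0|.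
by apply: le_trans (ub_le_sup _ S0) => //; eexists; exact: Sub.
Qed.

End ewens_law.

(** * Comparison of the rate with the variance *)

Section rate.
Variable R : realType.
Implicit Types (n : nat) (t : R).

Definition be_var n t : R := t * (ln (1 + n%:R / t) - 1 + t / (n%:R + t)).

(* [be_var n t] is the integral of t x / (t + x)^2 over [0, n], while
   [ewens_var n t] is the sum of the same function over 0, ..., n - 1. *)
Lemma be_varS n t : 0 < t ->
  be_var n.+1 t - be_var n t <= t * n.+1%:R / ((t + n%:R) * (t + n.+1%:R)).
Proof.
move=> t0.
have tn0 : 0 < t + n%:R by rewrite ltr_pwDl.
have tn1 : 0 < t + n.+1%:R by rewrite ltr_pwDl.
have q0 : 0 < 1 + (t + n%:R)^-1 by rewrite ltr_pwDl// invr_ge0 ltW.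
have q1 : 0 < 1 + n%:R / t by rewrite ltr_pwDl// divr_ge0// ltW.
rewrite -natr1 in tn1 *; rewrite /be_var -natr1.
have -> : 1 + (n%:R + 1) / t = (1 + (t + n%:R)^-1) * (1 + n%:R / t) :> R.
  by field; rewrite !gt_eqF.
rewrite lnM ?posrE//.
have /(ler_wpM2l (ltW t0)) : ln (1 + (t + n%:R)^-1) <= (t + n%:R)^-1.
  by apply: le_ln1Dx; rewrite (@lt_le_trans _ _ 0)// invr_ge0 ltW.
have : t * (n%:R + 1) / ((t + n%:R) * (t + (n%:R + 1))) =
    t * (t + n%:R)^-1 + t * (t / (n%:R + 1 + t)) - t * (t / (n%:R + t)).
  field; rewrite ?gt_eqF//; lra.
lra.
Qed.

Lemma be_var_le n t : 0 < t -> be_var n t <= 2 * ewens_var n t + 1.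
Proof.
(* The additive 1 is spent only on the first step, where the variance gains nothing and [be_var] at
   most 1. Later increments are at most twice the new summand, because (a + 1) / (t + a + 1) <= 2a /
   (t + a) for a >= 1. *)
move=> t0; suff : be_var n t <= 2 * ewens_var n t + (0 < n)%N%:R.
  by case: n => [|n] /=; lra.
elim: n => [|n IHn].
  rewrite /be_var /ewens_var big_ord0 mul0r addr0 ln1 !add0r divff ?gt_eqF//.
  by rewrite addNr !mulr0 addr0.
have := be_varS n t0.
have tn0 : 0 < t + n%:R by rewrite ltr_pwDl.
have tn1 : 0 < t + n.+1%:R by rewrite ltr_pwDl.
have -> : ewens_var n.+1 t = ewens_var n t + new_prob t n * (1 - new_prob t n).
  by rewrite /ewens_var big_ord_recr.
have -> : new_prob t n * (1 - new_prob t n) = t * n%:R / ((t + n%:R) * (t + n%:R)) :> R.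
  by rewrite /new_prob; field; rewrite gt_eqF.
case: n IHn tn0 tn1 => [|n] IHn tn0 tn1 /=.
  have : t * 1 / ((t + 0) * (t + 1)) <= 1.
    rewrite ler_pdivrMr ?mulr_gt0//; nra.
  move: IHn; rewrite /= mulr0 mul0r; lra.
have : t * n.+2%:R / ((t + n.+1%:R) * (t + n.+2%:R)) <=
    2 * (t * n.+1%:R / ((t + n.+1%:R) * (t + n.+1%:R))).
  rewrite [leRHS]mulrA ler_pdivrMr ?mulr_gt0// mulrAC ler_pdivlMr ?mulr_gt0//.
  rewrite -(natr1 n.+1) in tn1 *.
  have n1 : 1 <= n.+1%:R :> R by rewrite ler1n.
  set a : R := n.+1%:R in n1 tn0 tn1 *.
  have -> : 2 * (t * a) * ((t + a) * (t + (a + 1))) =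
    t * (a + 1) * ((t + a) * (t + a)) + t * (t + a) * ((a - 1) * t + a * a + a) by ring.
  rewrite lerDl !mulr_ge0 ?ltW//; nra.
by move: IHn; rewrite /=; lra.
Qed.

(* From [ln y >= 1 - 1/y] at [y = sqrt (1 + x)]. *)
Lemma be_var_ge n t : 0 < t ->
  t * (1 - (Num.sqrt (1 + n%:R / t))^-1) ^+ 2 <= be_var n t.
Proof.
move=> t0; rewrite /be_var (ler_wpM2l (ltW t0))//.
set x := n%:R / t; have x0 : 0 <= x by rewrite divr_ge0// ltW.
have -> : t / (n%:R + t) = (1 + x)^-1.
  have nt0 : 0 < n%:R + t by rewrite ltr_wpDl.
  by rewrite /x; field; rewrite !gt_eqF// addrC.
have x1 : 0 < 1 + x by rewrite ltr_pwDl.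
set q := Num.sqrt (1 + x); have q0 : 0 < q by rewrite sqrtr_gt0.
have qq : 1 + x = q ^+ 2 by rewrite sqr_sqrtr// ltW.
rewrite qq lnXn// mulr2n.
have lnVq : ln q^-1 <= q^-1 - 1.
  have qE : 1 + (q^-1 - 1) = q^-1 by ring.
  have := @le_ln1Dx R (q^-1 - 1); rewrite qE; apply.
  by rewrite ltrBrDr addNr invr_gt0.
move: lnVq; rewrite lnV ?posrE// -exprVn; lra.
Qed.

End rate.

(** * The three asymptotic regimes *)

Section asymptotics.
Variables (R : realType) (theta : nat -> R).
Hypothesis theta_gt0 : forall n : nat, (0 < n)%N -> 0 < theta n.
Hypothesis theta_ndecr :
  forall m n : nat, (0 < m)%N -> (m <= n)%N -> theta m <= theta n.

Local Notation V n := (be_var n (theta n)).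

(* [be_rate] is 0 where [V n] is not positive, hence the lower
   bound [2], which also absorbs the additive constant of [be_var_le]. *)
Lemma err_bigO (d : nat -> measure_display) (T : forall n : nat, measurableType (d n))
    (P : forall n : nat, probability (T n) R) (K : forall n : nat, {RV (P n) >-> R}) :
  (forall n : nat, (0 < n)%N -> has_ewens_law (K n) n (theta n)) ->
  (\forall n \near \oo, 2 <= V n) ->
  (fun n : nat => sup_norm (fun x : R =>
    dist_fun (standardized (K n)) x - std_normal_cdf x)) =O_\oo (be_rate theta).
Proof.
move=> K_law V2; apply/eqOP; near=> k; near=> n.
have n0 : (0 < n)%N by near: n; exists 1%N.
have t0 := theta_gt0 n0.
have Vn : 2 <= V n by near: n.
(* As [V n] is at least 2, the additive 1 is at most half of it. *)
have Vv : V n <= 4 * ewens_var n (theta n) by have := be_var_le n t0; lra.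
have v0 : 0 < ewens_var n (theta n) by lra.
have C3 : 0 <= stein_const R + 3 by have := stein_const_ge1 R; lra.
have /andP[err0 err_le] := ewens_berry_esseen n0 t0 (K_law n n0) v0.
rewrite (ger0_norm err0).
rewrite (le_trans err_le)// ger0_norm ?invr_ge0//.
rewrite (@le_trans _ _ (2 * (stein_const R + 3) * be_rate theta n))//; last first.
  by rewrite ler_wpM2r ?invr_ge0//; near: k; apply: nbhs_pinfty_ge; exact: num_real.
rewrite mulrAC [leRHS]mulrC ler_wpM2l// /be_rate/= -/(V n).
have sV : Num.sqrt (V n) <= 2 * Num.sqrt (ewens_var n (theta n)).
  have -> : 2 = Num.sqrt 4 :> R by rewrite -[LHS]ger0_norm// -sqrtr_sqr; congr Num.sqrt; ring.
  by rewrite -sqrtrM// ler_wsqrtr.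
rewrite ler_pdivlMr ?sqrtr_gt0; last lra.
by rewrite mulrC ler_pdivrMr ?sqrtr_gt0.
Unshelve. all: by end_near. Qed.

Lemma be_rate_bigO (c : R) (G : nat -> R) : 0 < c ->
  (\forall n \near \oo, 0 < G n /\ c ^+ 2 * G n <= V n) ->
  be_rate theta =O_\oo (fun n => (Num.sqrt (G n))^-1).
Proof.
move=> c0 VG; apply/eqOP; near=> k; near=> n.
have [G0 GV] : 0 < G n /\ c ^+ 2 * G n <= V n by near: n.
rewrite !ger0_norm ?invr_ge0//.
apply: (@le_trans _ _ (c^-1 * (Num.sqrt (G n))^-1)); last first.
  by rewrite ler_wpM2r ?invr_ge0//; near: k; apply: nbhs_pinfty_ge; exact: num_real.
rewrite -invfM /be_rate/= -/(V n).
have s0 : 0 < c * Num.sqrt (G n) by rewrite mulr_gt0// sqrtr_gt0.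
have sV : c * Num.sqrt (G n) <= Num.sqrt (V n).
  by rewrite -{1}(ger0_norm (ltW c0)) -sqrtr_sqr -sqrtrM ?sqr_ge0// ler_wsqrtr.
by rewrite lef_pV2 ?posrE// (lt_le_trans s0).
Unshelve. all: by end_near. Qed.

Lemma caseA_be_var : caseA theta ->
  \forall n \near \oo, 2 <= V n /\
    (0 < theta n * ln (n%:R / theta n) /\
     (2^-1) ^+ 2 * (theta n * ln (n%:R / theta n)) <= V n).
Proof.
(* A logarithm of at least 2 absorbs the -1 into half of it; since [theta n] is at least [theta 1],
   a logarithm of at least [4 / theta 1] then yields [V n >= 2]. *)
move=> cA; pose M := Num.max 2 (4 / theta 1).
near=> n.
have n0 : (0 < n)%N by near: n; exists 1%N.
have t0 := theta_gt0 n0; have t1 := theta_gt0 (ltn0Sn 0).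
have t1n := theta_ndecr (ltn0Sn 0) n0.
have xM : expR M <= n%:R / theta n.
  by near: n; move/cvgryPge : cA; apply.
have x0 : 0 < n%:R / theta n := lt_le_trans (expR_gt0 M) xM.
have lnM : M <= ln (n%:R / theta n) by rewrite -(expRK M) ler_ln ?posrE ?expR_gt0.
have ln2 : 2 <= ln (n%:R / theta n) by rewrite (le_trans _ lnM)// le_max lexx.
have ln4 : 4 <= theta n * ln (n%:R / theta n).
  rewrite (@le_trans _ _ (theta 1 * M))//.
    by rewrite mulrC -ler_pdivrMr// le_max lexx orbT.
  have M2 : 2 <= M by rewrite le_max lexx.
  by apply: ler_pM => //; [exact: ltW | lra].
have Vge : theta n * ln (n%:R / theta n) <= 2 * V n.
  rewrite /be_var mulrCA ler_wpM2l ?(ltW t0)//.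
  have : ln (n%:R / theta n) <= ln (1 + n%:R / theta n).
    by rewrite ler_ln ?posrE ?ltr_wpDl// lerDr.
  have : 0 <= theta n / (n%:R + theta n).
    by rewrite divr_ge0 ?addr_ge0// ltW.
  lra.
rewrite expr2; split; first lra.
split; lra.
Unshelve. all: by end_near. Qed.

(** Eventually n / theta lies between c / 2 and 2c: the lower bound feeds [be_var_ge] and fixes the
    constant, the upper one makes theta grow with n and so [V n] exceed 2. *)
Lemma caseB_be_var : caseB theta ->
  exists2 c : R, 0 < c & \forall n \near \oo, 2 <= V n /\
    (0 < theta n /\ c ^+ 2 * theta n <= V n).
Proof.
move=> [c c0 cB]; pose q := Num.sqrt (1 + c / 2).
have q1 : 1 < q.
  by rewrite -[ltLHS](@sqrtr1 R) ltr_sqrt; lra.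
have q0 : 0 < q by lra.
have k0 : 0 < 1 - q^-1 by rewrite subr_gt0 invf_lt1.
exists (1 - q^-1) => //; near=> n.
have n0 : (0 < n)%N by near: n; exists 1%N.
have t0 := theta_gt0 n0.
have xc : c / 2 <= n%:R / theta n.
  by near: n; apply: (cvgr_ge _ cB); lra.
have x2c : n%:R / theta n <= 2 * c.
  by near: n; apply: (cvgr_le _ cB); lra.
have kV : (1 - q^-1) ^+ 2 * theta n <= V n.
  rewrite (le_trans _ (be_var_ge n t0))// mulrC ler_wpM2l ?(ltW t0)//.
  have qn : q <= Num.sqrt (1 + n%:R / theta n).
    by rewrite ler_wsqrtr// lerD2l.
  rewrite lerXn2r ?nnegrE ?(ltW k0)//.
    by rewrite subr_ge0 invf_le1 ?(lt_le_trans q0)// (le_trans (ltW q1)).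
  by rewrite lerD2l lerN2 lef_pV2 ?posrE// (lt_le_trans q0).
split; last by [].
apply: le_trans kV.
have nM : 4 * c / (1 - q^-1) ^+ 2 <= n%:R.
  by near: n; exact: nbhs_infty_ger.
have k20 : 0 < (1 - q^-1) ^+ 2 by rewrite exprn_gt0.
move: nM x2c; rewrite ler_pdivrMr// ler_pdivrMr// => nM x2c.
have : 2 * (2 * c) <= (1 - q^-1) ^+ 2 * theta n * (2 * c).
  rewrite (le_trans _ (_ : n%:R * (1 - q^-1) ^+ 2 <= _))//; first lra.
  by rewrite mulrC -mulrA ler_wpM2l ?(ltW k20)// mulrC.
by rewrite ler_pM2r// mulr_gt0.
Unshelve. all: by end_near. Qed.

Lemma caseC1_be_var : caseC1 theta ->
  \forall n \near \oo, 2 <= V n /\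
    (0 < n%:R ^+ 2 / theta n /\ (6^-1) ^+ 2 * (n%:R ^+ 2 / theta n) <= V n).
Proof.
move=> [cx cy]; near=> n.
have n0 : (0 < n)%N by near: n; exists 1%N.
have t0 := theta_gt0 n0.
have x1 : n%:R / theta n <= 1.
  by near: n; apply: (cvgr_le _ cx); lra.
(* 72 is 2 times the square of 6, which turns the lower bound into 2. *)
have y72 : 72 <= n%:R ^+ 2 / theta n.
  by near: n; move/cvgryPge : cy; apply.
suff Vge : (6^-1) ^+ 2 * (n%:R ^+ 2 / theta n) <= V n.
  by split; [move: Vge; rewrite expr2; lra|split; [lra|]].
apply: le_trans (be_var_ge n t0).
set x := n%:R / theta n in x1 *.
have x0 : 0 <= x by rewrite divr_ge0// ltW.
have -> : n%:R ^+ 2 / theta n = theta n * x ^+ 2.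
  by rewrite /x; field; rewrite gt_eqF.
rewrite mulrCA ler_wpM2l ?(ltW t0)// -exprMn.
set q := Num.sqrt (1 + x).
have qq : q ^+ 2 = 1 + x by rewrite sqr_sqrtr// addr_ge0.
have q1 : 1 <= q by rewrite -[leLHS](@sqrtr1 R) ler_wsqrtr// lerDl.
have q2 : q <= 2 by nra.
have q0 : 0 < q by lra.
(* Here 1 - 1/q = x / (q (q + 1)), and q <= 2 gives the 6. *)
have k0 : 6^-1 * x <= 1 - q^-1.
  rewrite -(ler_pM2r q0) mulrBl mulVf ?gt_eqF//; nra.
have x60 : 0 <= 6^-1 * x by rewrite mulr_ge0.
by rewrite lerXn2r ?nnegrE// (le_trans x60).
Unshelve. all: by end_near. Qed.

End asymptotics.

Theorem corollary2p2 (R : realType) (theta : nat -> R)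
    (theta_gt0 : forall n : nat, (0 < n)%N -> 0 < theta n)
    (theta_ndecr : forall m n : nat, (0 < m)%N -> (m <= n)%N -> theta m <= theta n)
    (d : nat -> measure_display) (T : forall n : nat, measurableType (d n))
    (P : forall n : nat, probability (T n) R)
    (K : forall n : nat, {RV (P n) >-> R})
    (K_law : forall n : nat, (0 < n)%N -> has_ewens_law (K n) n (theta n)) :
  let err : nat -> R := fun n : nat =>
    sup_norm (fun x : R => dist_fun (standardized (K n)) x - std_normal_cdf x) in
  [/\ caseA theta ->
        err =O_\oo (be_rate theta) /\
        be_rate theta =O_\oo
          (fun n : nat => (Num.sqrt (theta n * ln (n%:R / theta n)))^-1),
      caseB theta ->
        err =O_\oo (be_rate theta) /\
        be_rate theta =O_\oo (fun n : nat => (Num.sqrt (theta n))^-1)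
    & caseC1 theta ->
        err =O_\oo (be_rate theta) /\
        be_rate theta =O_\oo
          (fun n : nat => (Num.sqrt (n%:R ^+ 2 / theta n))^-1)].
Proof.
move=> err; split => [/(caseA_be_var theta_gt0 theta_ndecr) near_V
  |/(caseB_be_var theta_gt0)[c c0 near_V]|/(caseC1_be_var theta_gt0) near_V];
  (split; first by apply: (err_bigO theta_gt0 K_law); apply: filterS near_V => n []).
- by apply: (be_rate_bigO (c := 2^-1)) => //; apply: filterS near_V => n [].
- by apply: (be_rate_bigO c0); apply: filterS near_V => n [].
- by apply: (be_rate_bigO (c := 6^-1)) => //; apply: filterS near_V => n [].
Qed.
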